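(* Let $k$ be a positive integer and define the $k$-Fibonacci sequence $(F_{k,n})_{n\ge 0}$ by $F_{k,0}=0$, $F_{k,1}=1$, $F_{k,n+2}=kF_{k,n+1}+F_{k,n}$, and the $k$-Lucas sequence $(L_{k,n})_{n\ge0}$ by $L_{k,0}=2$, $L_{k,1}=k$, $L_{k,n+2}=kL_{k,n+1}+L_{k,n}$. Let $a,d,k$ be positive integers with $d$ and $k$ odd and $d^2>8a$. If $n$ is a nonnegative integer with $n\equiv \pm 2 \pmod 6$ and $\gcd(a,L_{k,n})=1$, then \[ \left(\frac{\pm 4aF_{k,2n}+d^2}{L_{k,2n}}\right)=-\left(\frac{\pm 8aF_{k,n}+d^2L_{k,n}}{64a^2+(k^2+4)d^4}\right), \] (with the same choice of sign $\pm$ on both sides) whenever the Jacobi symbol on the right-hand side is proper.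
   Context: $\left(\frac{\cdot}{\cdot}\right)$ denotes the Jacobi symbol. *)

(* Defs.v *)
From mathcomp Require Import all_boot all_order all_algebra.

Set Implicit Arguments.
Unset Strict Implicit.
Unset Printing Implicit Defensive.

Import Order.TTheory GRing.Theory Num.Theory.
Local Open Scope ring_scope.

Fixpoint kfib (k n : nat) : nat :=
  match n with
  | 0%N => 0%N
  | 1%N => 1%N
  | (m.+1 as p).+1 => (k * kfib k p + kfib k m)%N
  end.

Fixpoint kluc (k n : nat) : nat :=
  match n with
  | 0%N => 2%N
  | 1%N => k
  | (m.+1 as p).+1 => (k * kluc k p + kluc k m)%N
  end.

(* Only meaningful when p is an odd prime. *)
Definition legendre (a : int) (p : nat) : int :=
  if (p %| a)%Z then 0
  else if [exists x : 'I_p, (x%:Z ^+ 2 == a %[mod p])%Z] then 1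
  else -1.

(* Only meaningful when the denominator b is odd (hence positive). *)
Definition jacobi (a : int) (b : nat) : int :=
  \prod_(p <- primes b) legendre a p ^+ logn p b.

(* A Jacobi symbol (a / b) is proper when its denominator is odd and positive
   and it does not vanish, i.e. a and b are coprime. *)
Definition jacobi_proper (a : int) (b : nat) : bool :=
  odd b && coprimez a b.

(* Main.v *)
(** Write [L = L_n], [F = F_n], [M = L_2n], [T = eps 8 a F + d^2 L] and
    [Q = 64 a^2 + (k^2 + 4) d^4], so that [F_2n = F L], [M = L^2 - 2] and
    [L^2 = (k^2 + 4) F^2 + 4].  Modulo [M], [L] times the numerator on the left
    is [T], so the left-hand symbol is [(L / M) (T / M)].  Modulo [T] one has
    [d^4 * 2M = F^2 Q], whence [(2M / T) = (Q / T)].  Since [M = 7] mod 8,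
    [T = L] mod 8, [L = 3] mod 4 and [Q = 1] mod 4, quadratic reciprocity for
    the Jacobi symbol turns this into [- (T / Q)]. *)

Require Import Defs.
From mathcomp Require Import all_boot all_order all_algebra.
From mathcomp Require Import all_fingroup all_solvable all_field.
From mathcomp Require Import zify ring.

Import Order.TTheory GRing.Theory Num.Theory.
Local Open Scope ring_scope.

(** * Euler's criterion in a finite field of odd order *)

Lemma finField_expf_unit (F : finFieldType) (x : F) :
  x != 0 -> x ^+ #|F|.-1 = 1.
Proof.
move=> x0; apply: (mulfI x0).
by rewrite -exprS mulr1 prednK ?expf_card //; apply/card_gt0P; exists x.
Qed.

(** The unit group is cyclic, generated by some [g]. If [x = g ^ i] has trivial power (q - 1)/2,
    then q - 1 divides i(q - 1)/2, so [i] is even and [g ^ (i / 2)] is a root. *)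
Lemma finField_euler (F : finFieldType) (x : F) : odd #|F| -> x != 0 ->
  reflect (exists y, y ^+ 2 = x) (x ^+ #|F|./2 == 1).
Proof.
move=> oF x0; apply: (iffP eqP) => [xh1|[y yx]]; last first.
  have y0 : y != 0 by apply: contraNneq x0 => y0; rewrite -yx y0 expr0n.
  by rewrite -yx -exprM -(finField_expf_unit F y y0); congr (_ ^+ _); lia.
have xu : x \in GRing.unit by rewrite unitfE.
have /cyclicP[g gE] := field_unit_group_cyclic [group of [set: {unit F}]].
have : FinRing.unit F xu \in <[g]>%g by rewrite -gE inE.
case/cycleP => i xg.
have val_g j : FinRing.uval (g ^+ j)%g = FinRing.uval g ^+ j.
  by elim: j => // j IH; rewrite expgS exprS -IH.
have : (g ^+ (i * #|F|./2) == 1)%g.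
  by apply/eqP/val_inj; rewrite /= val_g exprM -val_g -xg.
rewrite -order_dvdn orderE -gE card_finField_unit.
have F1 := finRing_gt1 F.
have -> : #|F|.-1 = (2 * #|F|./2)%N by move: oF F1; move: #|F| => q; lia.
rewrite dvdn_pmul2r; last by move: oF F1; move: #|F| => q; lia.
case/dvdnP => j ij; exists (FinRing.uval g ^+ j).
by rewrite -exprM -ij -val_g -xg.
Qed.

(** * The Legendre symbol: Euler's criterion, Gauss's lemma, the supplements *)

Section Legendre.
Variable p : nat.
Hypotheses (p_pr : prime p) (p_odd : odd p).

Lemma eq_intr_Fp (a b : int) :
  (a%:~R == b%:~R :> 'F_p) = (a == b %[mod p])%Z.
Proof.
by rewrite eqz_mod_dvd (dvdz_pcharf (pchar_Fp p_pr)) rmorphB subr_eq0.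
Qed.

Lemma intr_Fp_eq0 (a : int) : (a%:~R == 0 :> 'F_p) = (p %| a)%Z.
Proof. by rewrite (dvdz_pcharf (pchar_Fp p_pr)). Qed.

Lemma legendreE (a : int) : legendre a p =
  if (p %| a)%Z then 0 else if a%:~R ^+ p./2 == 1 :> 'F_p then 1 else -1.
Proof.
rewrite /legendre; case: ifPn => // pa; congr (if _ then _ else _).
have := @finField_euler 'F_p a%:~R; rewrite card_Fp // intr_Fp_eq0.
move=> /(_ p_odd pa) E; apply/existsP/E => -[x].
  rewrite -eq_intr_Fp => /eqP xa; exists (x : nat)%:~R.
  by rewrite -xa rmorphXn.
move=> xa; have xp : (x < p)%N by rewrite -[X in (_ < X)%N](Fp_cast p_pr).
exists (Ordinal xp); rewrite -eq_intr_Fp -xa rmorphXn /=.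
by rewrite -[X in _ == X ^+ _]natr_Zp.
Qed.

Lemma euler_legendre (a : int) : (legendre a p)%:~R = a%:~R ^+ p./2 :> 'F_p.
Proof.
rewrite legendreE; case: ifPn => [|].
  rewrite -intr_Fp_eq0 => /eqP ->; rewrite expr0n; case: eqP => //.
  by have := prime_gt1 p_pr; lia.
rewrite -intr_Fp_eq0 => a0; case: eqP => [-> //|/eqP nh].
have : (a%:~R ^+ p./2) ^+ 2 == 1 :> 'F_p.
  have := finField_expf_unit _ _ a0; rewrite card_Fp // => a1.
  by rewrite -exprM -[X in _ == X]a1; apply/eqP; congr (_ ^+ _); lia.
by rewrite sqrf_eq1 (negbTE nh) /= => /eqP ->.
Qed.

Lemma legendre_range (a : int) : legendre a p \in [:: 0; 1; -1].
Proof. by rewrite /legendre !inE; case: ifP => //; case: ifP. Qed.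

(** Two such values differ by at most 2 < p. This lets identities between symbols be proved in
    ['F_p]. *)
Lemma intr_Fp_inj_small (a b : int) :
  a \in [:: 0; 1; -1] -> b \in [:: 0; 1; -1] -> a%:~R = b%:~R :> 'F_p -> a = b.
Proof.
move=> ha hb /eqP; rewrite eq_intr_Fp eqz_mod_dvd => /dvdzP[c].
have := prime_gt1 p_pr; move: ha hb; rewrite !inE.
by move=> /or3P[]/eqP-> /or3P[]/eqP->; case: c => c; nia.
Qed.

Lemma legendreM (a b : int) : legendre (a * b) p = legendre a p * legendre b p.
Proof.
apply: intr_Fp_inj_small; first exact: legendre_range.
  have := legendre_range a; have := legendre_range b; rewrite !inE.
  by move=> /or3P[]/eqP-> /or3P[]/eqP->.
by rewrite rmorphM /= !euler_legendre rmorphM exprMn.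
Qed.

Lemma legendre_eqmod (a b : int) :
  (a == b %[mod p])%Z -> legendre a p = legendre b p.
Proof.
rewrite -eq_intr_Fp => /eqP ab; apply: intr_Fp_inj_small; rewrite ?legendre_range //.
by rewrite !euler_legendre ab.
Qed.

Lemma legendre_neq0 (a : int) : (legendre a p == 0) = (p %| a)%Z.
Proof. by rewrite /legendre; case: ifP => // _; case: ifP. Qed.

Lemma legendre_sqr (a : int) : ~~ (p %| a)%Z -> legendre (a ^+ 2) p = 1.
Proof.
rewrite -legendre_neq0 expr2 legendreM.
by have := legendre_range a; rewrite !inE => /or3P[]/eqP->.
Qed.

Lemma absres_subproof (a : nat) (i : 'I_p./2) :
  ((if a * i.+1 %% p <= p./2 then a * i.+1 %% p else p - a * i.+1 %% p).-1 < p./2)%N.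
Proof.
have := ltn_ord i; have := prime_gt1 p_pr.
have := ltn_pmod (a * i.+1) (prime_gt0 p_pr).
by case: ifP; move: p_odd; lia.
Qed.

(** The index [i] stands for i + 1 in 1, ..., (p - 1)/2. The value is, with the same shift, the
    absolute value of the least absolute residue of a(i + 1) modulo p. *)
Definition absres (a : nat) (i : 'I_p./2) : 'I_p./2 := Ordinal (absres_subproof a i).

Section GaussLemma.
Variable a : nat.
Hypothesis pa : ~~ (p %| a)%N.

Let upper (i : 'I_p./2) : bool := (p./2 < a * i.+1 %% p)%N.

Lemma absresE (i : 'I_p./2) :
  ((absres a i).+1 = if upper i then p - a * i.+1 %% p else a * i.+1 %% p)%N.
Proof.
rewrite /absres /= /upper ltnNge; case: ifP => /= _.
  rewrite prednK // lt0n -/(dvdn p _) Euclid_dvdM // (negbTE pa) /=.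
  by apply/negP => /dvdn_leq; have := ltn_ord i; lia.
by rewrite prednK // subn_gt0 ltn_pmod // prime_gt0.
Qed.

Lemma absres_Fp (i : 'I_p./2) :
  (a * i.+1)%:R = (-1) ^+ upper i * (absres a i).+1%:R :> 'F_p.
Proof.
rewrite -(Fp_nat_mod p_pr) absresE; case: (upper i); last by rewrite mul1r.
rewrite natrB; last by rewrite ltnW // ltn_pmod // prime_gt0.
by rewrite pchar_Fp_0 // sub0r mulrNN mul1r.
Qed.

(** Equal images give equal squares of a(i + 1) and a(j + 1), so i + 1 = ±(j + 1) modulo p; the
    minus sign would make p divide a positive sum that is at most p - 1. *)
Lemma absres_inj : injective (absres a).
Proof.
move=> i j ij; apply: val_inj => /=.
have a0 : a%:R != 0 :> 'F_p by rewrite -(dvdn_pcharf (pchar_Fp p_pr)).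
have sq (l : 'I_p./2) : (a%:R * l.+1%:R) ^+ 2 = (absres a l).+1%:R ^+ 2 :> 'F_p.
  by rewrite -natrM absres_Fp exprMn sqrr_sign mul1r.
have := sq i; rewrite ij -sq => /eqP; rewrite !exprMn.
rewrite (inj_eq (mulfI (expf_neq0 2 a0))) eqf_sqr -addr_eq0 -natrD.
rewrite -(dvdn_pcharf (pchar_Fp p_pr)); have := ltn_ord i; have := ltn_ord j.
move=> jp ip /orP[/eqP|/dvdn_leq]; last by lia.
by move/(congr1 (@nat_of_ord _)); rewrite !val_Fp_nat // !modn_small; lia.
Qed.

(** Parity count in a(i + 1) = pq + r with p odd. The last two signs are kept apart because they
    cancel in the product over [i], [absres a] being a permutation. *)
Lemma upper_sign (i : 'I_p./2) : (-1) ^+ upper i =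
  (-1) ^+ (a * i.+1 %/ p + a.+1 * i.+1) * ((-1) ^+ i.+1 * (-1) ^+ (absres a i).+1)
  :> int.
Proof.
rewrite -!exprD -signr_odd -[RHS]signr_odd; congr (_ ^+ (nat_of_bool _)).
have := divn_eq (a * i.+1) p; have := absresE i; rewrite mulSn /upper.
have := ltn_pmod (a * i.+1) (prime_gt0 p_pr).
move: (a * i.+1)%N (absres a i).+1 => b s.
move: (b %/ p)%N (b %% p)%N => q r rp sE bE.
have /(congr1 odd) := bE; rewrite oddD oddM p_odd andbT => ob.
have os : odd s = (p./2 < r)%N (+) odd r.
  by rewrite sE; case: ifP => // _; rewrite oddB ?p_odd // ltnW.
by rewrite !oddD ob os oddb; case: odd; case: odd; case: odd; case: (p./2 < r)%N.
Qed.

(* The familiar exponent is the number of residues [a * i] above [p / 2];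
   reducing [a * i = p * q + r] modulo 2 gives this one. *)
Lemma legendre_gauss : legendre a p =
  (-1) ^+ (\sum_(i < p./2) (a * i.+1 %/ p + a.+1 * i.+1)).
Proof.
transitivity (\prod_(i < p./2) (-1) ^+ upper i : int); last first.
  under eq_bigr do rewrite upper_sign.
  rewrite !big_split prodrXr.
  have <- : \prod_(i < p./2) (-1) ^+ i.+1 = \prod_i (-1) ^+ (absres a i).+1 :> int.
    by rewrite (reindex_inj absres_inj).
  by rewrite /= prodrXr -exprD addnn -mul2n exprM sqrrN !expr1n mulr1 big_split.
apply: intr_Fp_inj_small; first exact: legendre_range.
  by rewrite prodrXr -signr_odd !inE; case: odd.
rewrite euler_legendre // -pmulrn rmorph_prod /=.
(* Both sides get multiplied by the factorial of [p./2], nonzero modulo p; permuting its factors by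
   [absres a] on the right reduces the claim to [absres_Fp]. *)
have X0 : \prod_(i < p./2) i.+1%:R != 0 :> 'F_p.
  apply/prodf_neq0 => i _; rewrite -(dvdn_pcharf (pchar_Fp p_pr)).
  by apply/negP => /dvdn_leq; have := ltn_ord i; lia.
apply: (mulIf X0); rewrite [X in _ = _ * X](reindex_inj absres_inj) -big_split /=.
rewrite -[X in _ ^+ X]card_ord -prodr_const -big_split /=.
apply: eq_bigr => i _; rewrite -natrM absres_Fp.
by rewrite -(rmorph_sign (intr : int -> 'F_p)).
Qed.

End GaussLemma.

Lemma legendreN1 : legendre (-1) p = (-1) ^+ p./2.
Proof.
apply: intr_Fp_inj_small; first exact: legendre_range.
  by rewrite -signr_odd !inE; case: odd.
by rewrite euler_legendre rmorphXn.
Qed.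

(** For a = 2 all quotients in [legendre_gauss] vanish. What remains is 3h(h + 1)/2 with h = (p -
    1)/2, whose parity depends on h modulo 4. *)
Lemma legendre2 : legendre 2 p = (-1) ^+ ((p %% 8 == 3) || (p %% 8 == 5))%N.
Proof.
have p2 : ~~ (p %| 2)%N.
  by apply: contraL p_odd => /prime_nt_dvdP -> //; case: (p) p_pr => [|[]].
rewrite (legendre_gauss 2 p2) -signr_odd -[RHS]signr_odd; congr (_ ^+ nat_of_bool _).
have sumE h : (2 * \sum_(i < h) i.+1 = h * h.+1)%N.
  by elim: h => [|h IH]; rewrite ?big_ord0 // big_ord_recr /= mulnDr IH; lia.
have -> : (\sum_(i < p./2) (2 * i.+1 %/ p + 3 * i.+1) = 3 * \sum_(i < p./2) i.+1)%N.
  rewrite big_distrr; apply: eq_bigr => i _ /=.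
  by rewrite divn_small //; have := ltn_ord i; lia.
move: (sumE p./2); move: (\sum_(_ < _) _)%N => S.
have := divn_eq p./2 4; have := ltn_pmod p./2 (isT : 0 < 4)%N.
move: (p./2 %/ 4)%N (p./2 %% 4)%N => q r r4 hE SE.
have : (p = 2 * (q * 4 + r) + 1)%N by rewrite -hE; move: p_odd; lia.
move: SE; rewrite hE => {hE sumE p2}.
have -> : ((q * 4 + r) * (q * 4 + r).+1 = 16 * (q * q) + 8 * q * r + 4 * q + r * r.+1)%N by ring.
move: (q * q)%N => t.
by case: r r4 => [|[|[|[|]]]] //= _ SE pE; lia.
Qed.

Lemma legendre_gauss_odd (a : nat) : odd a -> ~~ (p %| a)%N ->
  legendre a p = (-1) ^+ (\sum_(i < p./2) (a * i.+1 %/ p)).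
Proof.
move=> ao pa; rewrite legendre_gauss // big_split /= exprD -big_distrr exprM.
by rewrite -(signr_odd _ a.+1) /= ao expr1n mulr1.
Qed.

End Legendre.

(** * Quadratic reciprocity for primes *)

Lemma sum_ltn_ord (c K : nat) : (c <= K -> \sum_(j < K) (j < c) = c)%N.
Proof.
elim: K c => [|K IH] [|c] cK; first 1 [by rewrite big_ord0 | by [] | by rewrite big1].
by rewrite big_ord_recl /= IH.
Qed.

(* Eisenstein: both sums count lattice points in the rectangle
   [1, p/2] x [1, q/2], on either side of the diagonal. *)
Lemma legendre_reciprocity (p q : nat) :
  prime p -> prime q -> odd p -> odd q -> p != q ->
  legendre p q * legendre q p = (-1) ^+ (p./2 * q./2).
Proof.
move=> p_pr q_pr p_odd q_odd pq.
have npq : ~~ (p %| q)%N by rewrite dvdn_prime2.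
have nqp : ~~ (q %| p)%N by rewrite dvdn_prime2 // eq_sym.
rewrite !legendre_gauss_odd // -exprD; congr (_ ^+ _).
have count r s : prime r -> odd r -> odd s ->
    (\sum_(i < r./2) (s * i.+1 %/ r) =
     \sum_(i < r./2) \sum_(j < s./2) (r * j.+1 <= s * i.+1))%N.
  move=> r_pr r_odd s_odd; apply: eq_bigr => i _.
  (* The quotient is the number of lattice points in column i + 1; it is at most [s./2] because i +
     1 is at most [r./2]. *)
  rewrite -[LHS](@sum_ltn_ord _ s./2).
    by apply: eq_bigr => j _; rewrite leq_divRL ?prime_gt0 // mulnC.
  rewrite -ltnS ltn_divLR ?prime_gt0 //.
  by have := ltn_ord i; move: (i : nat) r_odd s_odd => k; nia.
rewrite (count q) // (count p) // [X in (X + _)%N]exchange_big -big_split /=.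
rewrite -[X in (X * _)%N]card_ord -sum_nat_const; apply: eq_bigr => i _.
rewrite -[RHS]card_ord -sum1_card -big_split; apply: eq_bigr => j _ /=.
(* Off the diagonal each point is counted once. A point on it would make p divide i + 1 < p. *)
case: ltngtP => // E.
have : (p %| q * i.+1)%N by rewrite E dvdn_mulr.
by rewrite Euclid_dvdM // (negbTE npq) /= => /dvdn_leq; have := ltn_ord i; lia.
Qed.

(** * The Jacobi symbol: multiplicativity, supplements, reciprocity *)

Lemma jacobi1 (a : int) : jacobi a 1 = 1.
Proof. by rewrite /jacobi big_nil. Qed.

Lemma jacobi_prime (a : int) (p : nat) : prime p -> jacobi a p = legendre a p.
Proof.
by move=> p_pr; rewrite /jacobi primes_prime // big_seq1 logn_prime // eqxx.
Qed.

(** The extra indices have exponent 0. A common range allows products for different denominators to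
    be compared factor by factor. *)
Lemma jacobi_widen (a : int) (b N : nat) : (0 < b <= N)%N ->
  jacobi a b = \prod_(0 <= p < N.+1) legendre a p ^+ logn p b.
Proof.
move=> /andP[b0 bN]; rewrite /jacobi [RHS](bigID (mem (primes b))) /=.
rewrite [X in _ * X]big1 ?mulr1; last first.
  move=> p; rewrite mem_primes b0 /= => pb; rewrite lognE b0.
  by case: ifP pb => // /and3P[-> _ ->].
rewrite -[RHS]big_filter; apply: perm_big; apply: uniq_perm.
- exact: primes_uniq.
- by rewrite filter_uniq // iota_uniq.
move=> p; rewrite mem_filter mem_index_iota /= ltnS mem_primes.
case: and3P => //= -[p_pr _ /dvdn_leq pb]; rewrite (leq_trans _ bN) //; exact: pb.
Qed.

Lemma jacobiMr (a : int) (b c : nat) : (0 < b)%N -> (0 < c)%N ->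
  jacobi a (b * c) = jacobi a b * jacobi a c.
Proof.
move=> b0 c0; rewrite !(@jacobi_widen a _ (b * c));
  rewrite ?muln_gt0 ?b0 ?c0 ?leqnn ?leq_pmull ?leq_pmulr //.
by rewrite -big_split; apply: eq_bigr => p _; rewrite lognM // exprD.
Qed.

(** Splits off the smallest prime factor; this induction transfers facts from Legendre to Jacobi
    symbols. *)
Lemma odd_prime_ind (P : nat -> Prop) : P 1%N ->
  (forall p m, prime p -> odd p -> odd m -> P m -> P (p * m)%N) ->
  forall n, odd n -> P n.
Proof.
move=> P1 Pp n; elim/ltn_ind: n => n IH on.
have [->//|n1] := eqVneq n 1%N.
have p_pr : prime (pdiv n) by apply: pdiv_prime; move: on n1; case: n {IH} => [|[]].
have nE : n = (pdiv n * (n %/ pdiv n))%N by rewrite mulnC divnK // pdiv_dvd.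
have := on; rewrite {1}nE oddM => /andP[op om].
rewrite nE; apply: Pp => //; apply: IH => //.
by rewrite ltn_Pdiv ?prime_gt1 ?odd_gt0.
Qed.

Lemma jacobiMl (a b : int) (n : nat) : odd n ->
  jacobi (a * b) n = jacobi a n * jacobi b n.
Proof.
elim/odd_prime_ind: n / => [|p m p_pr op om IH]; first by rewrite !jacobi1.
by rewrite !jacobiMr ?odd_gt0 // !(@jacobi_prime _ p) // legendreM // IH mulrACA.
Qed.

Lemma jacobi_eqmod (a b : int) (n : nat) : odd n -> (n %| a - b)%Z ->
  jacobi a n = jacobi b n.
Proof.
elim/odd_prime_ind: n / => [|p m p_pr op om IH]; first by rewrite !jacobi1.
rewrite PoszM => ab; rewrite !jacobiMr ?odd_gt0 // !(@jacobi_prime _ p) // IH.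
  by rewrite (@legendre_eqmod p p_pr op a b) // eqz_mod_dvd (dvdz_trans _ ab) ?dvdz_mulr.
by rewrite (dvdz_trans _ ab) ?dvdz_mull.
Qed.

Lemma jacobi_sqr (a : int) (n : nat) : odd n -> coprimez a n -> jacobi a n ^+ 2 = 1.
Proof.
elim/odd_prime_ind: n / => [|p m p_pr op om IH]; first by rewrite !jacobi1.
rewrite PoszM coprimezMr => /andP[ap am].
rewrite !jacobiMr ?odd_gt0 // !(@jacobi_prime _ p) // exprMn IH // mulr1.
rewrite expr2 -legendreM // -expr2 legendre_sqr //.
by move: ap; rewrite coprimez_sym coprimezE prime_coprime.
Qed.

Lemma jacobi_sign (a : int) (n : nat) : odd n -> coprimez a n ->
  jacobi a n = 1 \/ jacobi a n = -1.
Proof.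
move=> on an; have /eqP := jacobi_sqr a n on an.
by rewrite sqrf_eq1 => /orP[]/eqP; [left | right].
Qed.

(** For m = 2r + 1 and n = 2s + 1 the half of mn is 2rs + r + s. *)
Lemma signr_half_oddM (m n : nat) : odd m -> odd n ->
  (-1) ^+ (m * n)./2 = (-1) ^+ m./2 * (-1) ^+ n./2 :> int.
Proof.
move=> om on; rewrite -exprD -[LHS]signr_odd -[RHS]signr_odd; congr (_ ^+ nat_of_bool _).
have mE : m = (m./2 * 2 + 1)%N by move: om; lia.
have nE : n = (n./2 * 2 + 1)%N by move: on; lia.
move: (m./2) (n./2) mE nE => r s -> ->.
have -> : ((r * 2 + 1) * (s * 2 + 1) = 2 * (2 * (r * s) + r + s) + 1)%N by ring.
by move: (r * s)%N => t; lia.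
Qed.

Lemma jacobiN1 (n : nat) : odd n -> jacobi (-1) n = (-1) ^+ n./2.
Proof.
elim/odd_prime_ind: n / => [|p m p_pr op om IH]; first by rewrite !jacobi1.
by rewrite jacobiMr ?odd_gt0 // jacobi_prime // legendreN1 // IH signr_half_oddM.
Qed.

Lemma jacobi2 (n : nat) : odd n ->
  jacobi 2 n = (-1) ^+ ((n %% 8 == 3) || (n %% 8 == 5))%N.
Proof.
elim/odd_prime_ind: n / => [|p m p_pr op om IH]; first by rewrite !jacobi1.
rewrite jacobiMr ?odd_gt0 // jacobi_prime // legendre2 // IH -modnMm.
have : odd (p %% 8) by move: op; lia.
have : odd (m %% 8) by move: om; lia.
have := ltn_pmod p (isT : 0 < 8)%N; have := ltn_pmod m (isT : 0 < 8)%N.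
(* Finite check that the sign is multiplicative on odd residues modulo 8. *)
move: (m %% 8)%N (p %% 8)%N => r s.
by move: r s => [|[|[|[|[|[|[|[|r]]]]]]]] [|[|[|[|[|[|[|[|s]]]]]]]].
Qed.

(** Both sides are multiplicative in each argument, so induction on [m] and then on [n] leaves a
    pair of primes, distinct by coprimality. *)
Lemma jacobi_reciprocity (m n : nat) : odd m -> odd n -> coprime m n ->
  jacobi m n * jacobi n m = (-1) ^+ (m./2 * n./2).
Proof.
move=> om on mn; elim/odd_prime_ind: m / om mn => [_|p m p_pr op om IHm].
  rewrite jacobi1 mulr1 mul0n expr0.
  elim/odd_prime_ind: n / on => [|q l q_pr oq ol IH]; first by rewrite jacobi1.
  rewrite jacobiMr ?odd_gt0 // IH mulr1 jacobi_prime //.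
  by rewrite -(legendre_sqr q q_pr oq 1) ?expr1n // dvdzE /= Euclid_dvd1.
rewrite coprimeMl => /andP[pn mn].
rewrite PoszM jacobiMl // jacobiMr ?odd_gt0 // mulrACA IHm //.
rewrite [RHS]exprM signr_half_oddM // exprMn -!exprM; congr (_ * _).
elim/odd_prime_ind: n / on pn {IHm mn} => [_|q l q_pr oq ol IH].
  rewrite jacobi1 mul1r muln0 expr0 jacobi_prime //.
  by rewrite -(legendre_sqr p p_pr op 1) ?expr1n // dvdzE /= Euclid_dvd1.
rewrite coprimeMr => /andP[pq pl].
rewrite PoszM jacobiMl // jacobiMr ?odd_gt0 // mulrACA IH //.
rewrite [(p./2 * (q * l)./2)%N]mulnC [RHS]exprM signr_half_oddM // exprMn -!exprM.
rewrite (mulnC l./2) (mulnC q./2); congr (_ * _).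
rewrite !jacobi_prime //; apply: legendre_reciprocity => //.
by apply: contraTneq pq => ->; rewrite prime_coprime // dvdnn.
Qed.

Lemma jacobi_eq_primes (a b : int) (n : nat) :
  (forall p, prime p -> (p %| n)%N -> legendre a p = legendre b p) ->
  jacobi a n = jacobi b n.
Proof.
move=> ab; apply: eq_big_seq => p; rewrite mem_primes => /and3P[p_pr _ pn].
by rewrite ab.
Qed.

(** * Identities and parities of the two sequences *)

Lemma kfibSS k n : kfib k n.+2 = (k * kfib k n.+1 + kfib k n)%N.
Proof. by []. Qed.

Lemma klucSS k n : kluc k n.+2 = (k * kluc k n.+1 + kluc k n)%N.
Proof. by []. Qed.

(** Eliminates the Lucas terms, so that later identities become polynomial ones in two consecutive
    Fibonacci terms. *)
Lemma kluc_kfib k n : (kluc k n)%:Z = 2 * (kfib k n.+1)%:Z - k%:Z * (kfib k n)%:Z.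
Proof.
elim/ltn_ind: n => -[|[|n]] IH; [by rewrite /=; lia| by rewrite /=; lia|].
rewrite klucSS PoszD PoszM (IH n.+1) // (IH n) // !kfibSS !PoszD !PoszM !PoszD !PoszM; ring.
Qed.

Lemma kfib_cassini k n :
  (kfib k n.+1)%:Z ^+ 2 - k%:Z * (kfib k n.+1)%:Z * (kfib k n)%:Z - (kfib k n)%:Z ^+ 2
  = (-1) ^+ n.
Proof.
elim: n => [|n IH]; first by rewrite /=; ring.
by rewrite [RHS]exprS -IH kfibSS PoszD PoszM; ring.
Qed.

(** The two identities need each other in the induction; [kluc_double] uses both. *)
Lemma kfib_double k n :
  (kfib k (2 * n))%:Z = (kfib k n)%:Z * (kluc k n)%:Z /\
  (kfib k (2 * n).+1)%:Z = (kfib k n.+1)%:Z ^+ 2 + (kfib k n)%:Z ^+ 2.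
Proof.
elim: n => [|n [IH0 IH1]]; first by split; rewrite /=; ring.
have -> : (2 * n.+1 = (2 * n).+2)%N by lia.
rewrite !kluc_kfib in IH0 *.
by rewrite !kfibSS !PoszD !PoszM PoszD PoszM IH0 IH1; split; ring.
Qed.

Lemma kluc_double k n : (kluc k (2 * n))%:Z = (kluc k n)%:Z ^+ 2 - 2 * (-1) ^+ n.
Proof.
rewrite kluc_kfib; have [-> ->] := kfib_double k n.
by rewrite -(kfib_cassini k) kluc_kfib; ring.
Qed.

Lemma kluc_sqr k n :
  (kluc k n)%:Z ^+ 2 = (k%:Z ^+ 2 + 4) * (kfib k n)%:Z ^+ 2 + 4 * (-1) ^+ n.
Proof. by rewrite -(kfib_cassini k) kluc_kfib; ring. Qed.

(** Modulo 2, with k odd, the recurrence gives period 3. *)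
Lemma odd_kfib k n : odd k -> odd (kfib k n) = ~~ (3 %| n)%N.
Proof.
move=> ok; elim/ltn_ind: n => -[|[|[|n]]] IH //; first by rewrite /= muln1 addn0 ok.
have := IH n (leqW (leqW (leqnn n.+1))); rewrite !kfibSS !oddD !oddM !oddD !oddM ok /= => ->.
have -> : (3 %| n.+3)%N = (3 %| n)%N by lia.
by rewrite addbAC addbb addFb.
Qed.

Lemma odd_kluc k n : odd (kluc k n) = odd k && odd (kfib k n).
Proof.
have /(congr1 odd) : (kluc k n + k * kfib k n = 2 * kfib k n.+1)%N.
  by have := kluc_kfib k n; lia.
by rewrite oddD !oddM /=; case: odd; case: odd; case: odd.
Qed.

Lemma Euclid_dvdzM (p : nat) (a b : int) : prime p ->
  (p %| a * b)%Z = (p %| a)%Z || (p %| b)%Z.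
Proof. by move=> p_pr; rewrite !dvdzE abszM Euclid_dvdM. Qed.

Lemma Euclid_dvdzX (p : nat) (a : int) (n : nat) : prime p ->
  (p %| a ^+ n)%Z = (p %| a)%Z && (0 < n)%N.
Proof. by move=> p_pr; rewrite !dvdzE abszX Euclid_dvdX. Qed.

(** * The reciprocity argument, with [D] for k^2 + 4 and [e] for the sign *)

Section Reduction.
Variables (a d D F L M : int) (T Q : nat) (e : int).
Hypotheses (e2 : e ^+ 2 = 1) (DF : L ^+ 2 = D * F ^+ 2 + 4) (ML : M = L ^+ 2 - 2).
Hypotheses (TE : T%:Z = e * (8 * a * F) + d ^+ 2 * L).
Hypotheses (QE : Q%:Z = 64 * a ^+ 2 + D * d ^+ 4).
Hypotheses (oT : odd T) (TQ : coprime T Q).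

(* Modulo [p] the identity [d^4 * 2M = F^2 * Q] gives the claim unless [p]
   divides [d * F]; then it divides both, and both sides are nonzero squares. *)
Lemma legendre_2M_Q (p : nat) : prime p -> (p %| T)%N ->
  legendre (2 * M) p = legendre Q p.
Proof.
move=> p_pr pT.
have p_odd : odd p by rewrite (dvdn_odd pT).
have pQ : ~~ (p %| Q%:Z)%Z.
  apply: contraL TQ => pQ; apply/negP => /(coprime_dvdl pT).
  by rewrite prime_coprime // => /negP; apply.
have p2 : ~~ (p %| 2%:Z)%Z.
  by rewrite dvdzE /=; apply: contraL p_odd => /prime_nt_dvdP -> //; case: (p) p_pr => [|[]].
have pX2 m : ~~ (p %| (2 ^ m)%N%:Z)%Z by rewrite dvdzE /= Euclid_dvdX // negb_and p2.
have pTz : (p %| e * (8 * a * F) + d ^+ 2 * L)%Z by rewrite -TE.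
have pe : ~~ (p %| e)%Z.
  apply/negP => pe; have : (p %| e ^+ 2)%Z by rewrite Euclid_dvdzX // pe.
  by rewrite e2 dvdzE /= Euclid_dvd1.
have M2 : 2 * M = L ^+ 2 + D * F ^+ 2 by rewrite ML DF; ring.
have [pF|pF] := boolP (p %| F)%Z.
  have pL : ~~ (p %| L)%Z.
    apply: contra (pX2 2) => pL.
    have -> : (2 ^ 2)%N%:Z = L ^+ 2 - D * F ^+ 2 :> int by rewrite DF; ring.
    by rewrite rpredB ?dvdz_mull // Euclid_dvdzX // ?pL ?pF.
  have pd : (p %| d)%Z.
    move: pTz; rewrite rpredDl; last by rewrite !dvdz_mull.
    rewrite Euclid_dvdzM // (negbTE pL) orbF.
    by rewrite Euclid_dvdzX // andbT.
  have pa : ~~ (p %| a)%Z.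
    by apply: contra pQ => pa; rewrite QE rpredD ?dvdz_mull // Euclid_dvdzX // ?pa ?pd.
  rewrite (legendre_eqmod p p_pr p_odd (2 * M) (L ^+ 2)); last first.
    by rewrite M2 eqz_mod_dvd addrAC subrr add0r dvdz_mull // Euclid_dvdzX // pF.
  rewrite (legendre_eqmod p p_pr p_odd Q ((8 * a) ^+ 2)); last first.
    rewrite QE eqz_mod_dvd.
    have -> : 64 * a ^+ 2 + D * d ^+ 4 - (8 * a) ^+ 2 = D * d ^+ 4 by ring.
    by rewrite dvdz_mull // Euclid_dvdzX // pd.
  by rewrite !legendre_sqr // Euclid_dvdzM // negb_or pa (pX2 3%N).
have pd : ~~ (p %| d)%Z.
  apply: contra pQ => pd; move: pTz.
  rewrite rpredDr; last by rewrite dvdz_mulr // Euclid_dvdzX // pd.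
  rewrite !Euclid_dvdzM // (negbTE pe) (negbTE pF) orbF (negbTE (pX2 3%N)) /= => pa.
  by rewrite QE rpredD ?dvdz_mull // Euclid_dvdzX // ?pa ?pd.
have sqr1 x : ~~ (p %| x)%Z -> legendre (x ^+ 2) p = 1 by exact: legendre_sqr.
transitivity (legendre ((d ^+ 2) ^+ 2 * (2 * M)) p).
  by rewrite [RHS]legendreM // sqr1 ?mul1r // Euclid_dvdzX // negb_and pd.
transitivity (legendre (F ^+ 2 * Q) p); last by rewrite legendreM // sqr1 // mul1r.
apply: legendre_eqmod => //; rewrite eqz_mod_dvd.
(* The terms in [D] cancel, leaving (d^2 L)^2 - (8aF)^2; as e^2 = 1 this factors as T times its
   conjugate. *)
have -> : (d ^+ 2) ^+ 2 * (2 * M) - F ^+ 2 * Q =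
    T%:Z * (d ^+ 2 * L - e * (8 * a * F)).
  rewrite TE QE M2.
  transitivity (d ^+ 4 * L ^+ 2 - e ^+ 2 * (64 * a ^+ 2 * F ^+ 2)); last by ring.
  by rewrite e2; ring.
by rewrite dvdz_mulr.
Qed.

Lemma jacobi_2M_Q : jacobi (2 * M) T = jacobi Q T.
Proof. by apply: jacobi_eq_primes => p p_pr pT; rewrite legendre_2M_Q. Qed.

(** At a common prime of [2 * M] and [T] the symbol of [Q] would vanish too, against the coprimality
    of [T] and [Q]. *)
Lemma coprime_2M_T : coprimez (2 * M) T.
Proof.
rewrite coprimezE /=; apply: contraT => ncop.
have g1 : (1 < gcdn `|(2 * M)%R| T)%N.
  by rewrite ltn_neqAle eq_sym -/(coprime _ _) ncop gcdn_gt0 (odd_gt0 oT) orbT.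
have p_pr := pdiv_prime g1; set p := pdiv _ in p_pr.
have : (p %| gcdn `|(2 * M)%R| T)%N by exact: pdiv_dvd.
rewrite dvdn_gcd => /andP[pM pT].
have := legendre_neq0 p (2 * M); rewrite legendre_2M_Q // dvdzE pM.
rewrite legendre_neq0 dvdzE => pQ.
by have := coprime_dvdl pT TQ; rewrite prime_coprime // pQ.
Qed.

Variables m l : nat.
Hypotheses (mE : M = m) (lE : L = l).
Hypotheses (l4 : (l %% 4 = 3)%N) (Q4 : (Q %% 4 = 1)%N) (Tl : (T %% 8 = l %% 8)%N).

Lemma jacobi_reduction :
  jacobi (e * (4 * a * (F * L)) + d ^+ 2) m = - jacobi T Q.
Proof.
have ol : odd l by lia.
have oQ : odd Q by lia.
have m_l : (m + 2 = l * l)%N by have := ML; rewrite mE lE; lia.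
have m8 : (m %% 8 = 7)%N.
  have : ((m + 2) %% 8 = 1)%N.
    rewrite m_l -modnMm; move: l4; have : ((l %% 8 == 3) || (l %% 8 == 7))%N by lia.
    by case/orP=> /eqP->.
  lia.
have om : odd m by lia.
have lm : coprime l m.
  have := ol; rewrite -coprimen2 /coprime => /eqP l2.
  rewrite /coprime -dvdn1 -l2 dvdn_gcd dvdn_gcdl.
  by rewrite -(dvdn_addr 2 (dvdn_gcdr l m)) m_l dvdn_mulr // dvdn_gcdl.
have [mT T2] : coprimez M T /\ coprimez 2 T.
  by have := coprime_2M_T; rewrite coprimezMl => /andP[].
have Tm : coprime T m by move: mT; rewrite mE coprime_sym.
(* [T], [m] and [l] are all 3 modulo 4, so reciprocity between two of them changes the sign; with
   [Q] it does not. *)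
have oT4 : odd T./2 by lia.
have om2 : odd m./2 by lia.
have ol2 : odd l./2 by lia.
have sgn u v : odd u -> odd v -> (-1) ^+ (u * v) = -1 :> int.
  by move=> ou ov; rewrite -signr_odd oddM ou ov.
have l2 : coprimez 2 l by rewrite coprimezE /= coprime2n.
have num : jacobi l m * jacobi (e * (4 * a * (F * L)) + d ^+ 2) m = jacobi T m.
  rewrite -jacobiMl //; apply: jacobi_eqmod => //; rewrite -mE.
  (* [L] times the numerator minus [T] is 4eaF(L^2 - 2). *)
  apply/dvdzP; exists (4 * e * a * F); rewrite TE ML -lE; ring.
have lm_ml := jacobi_reciprocity l m ol om lm; rewrite sgn // in lm_ml.
have m_l2 : jacobi m l = - jacobi 2 l.
  (* m = l^2 - 2 is -2 modulo l. *)
  transitivity (jacobi (-1 * 2) l).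
    by apply: jacobi_eqmod => //; apply/dvdzP; exists l%:Z; lia.
  by rewrite jacobiMl // jacobiN1 // -signr_odd ol2 mulN1r.
have Tm_mT := jacobi_reciprocity T m oT om Tm; rewrite sgn // in Tm_mT.
have TQ_QT := jacobi_reciprocity T Q oT oQ TQ.
rewrite mulnC exprM -(signr_odd _ Q./2) in TQ_QT.
have oQ2 : odd Q./2 = false by clear -Q4; lia.
rewrite oQ2 expr1n in TQ_QT.
have := jacobi_2M_Q; rewrite jacobiMl // jacobi2 // Tl -jacobi2 // mE => q.
have := jacobi_sign 2 l ol l2; have := jacobi_sign l m om lm.
move: num lm_ml m_l2 Tm_mT TQ_QT q.
move: (jacobi l m) (jacobi m l) (jacobi 2 l) (jacobi T m) (jacobi m T).
move: (jacobi T Q) (jacobi Q T) (jacobi (_ + _) m).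
move=> r r' N x x' y t t' num xy yE Nt rt q x1 y1.
rewrite -{}num -{}q {}yE in Nt rt xy *.
(* [N] is the left-hand symbol and [r] is (T / Q). Here x = y = ±1, x N t' = -1 and r y t' = 1;
   adding gives the claim, and t' is nonzero. *)
have /eqP : (N + r) * t' = 0.
  by case: x1 y1 xy Nt rt => -> [] -> //; clear; lia.
rewrite mulf_eq0 addr_eq0 => /orP[/eqP //|/eqP t0].
by rewrite t0 !mulr0 in Nt.
Qed.
End Reduction.

(** * Residues and positivity needed to apply the reduction *)

Theorem theorem1 (a d k n : nat) (eps : int)
    (ha : (0 < a)%N) (hd : (0 < d)%N) (hk : (0 < k)%N)
    (hdodd : odd d) (hkodd : odd k) (hda : (8 * a < d ^ 2)%N)
    (hn : (n%:Z = 2 %[mod 6])%Z \/ (n%:Z = - 2 %[mod 6])%Z)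
    (hgcd : gcdn a (kluc k n) = 1%N)
    (heps : eps = 1 \/ eps = - 1)
    (hproper : jacobi_proper
       (eps * (8 * a * kfib k n)%N%:Z + (d ^ 2 * kluc k n)%N%:Z)
       (64 * a ^ 2 + (k ^ 2 + 4) * d ^ 4)%N) :
  jacobi (eps * (4 * a * kfib k (2 * n))%N%:Z + (d ^ 2)%N%:Z)
         (kluc k (2 * n))
  = - jacobi (eps * (8 * a * kfib k n)%N%:Z + (d ^ 2 * kluc k n)%N%:Z)
             (64 * a ^ 2 + (k ^ 2 + 4) * d ^ 4)%N.
Proof.
have [on n3] : odd n = false /\ ~~ (3 %| n)%N by clear -hn; split; lia.
have sgn1 : (-1) ^+ n = 1 :> int by rewrite -signr_odd on.
have LL := kluc_double k n; rewrite sgn1 mulr1 in LL.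
have DF := kluc_sqr k n; rewrite sgn1 mulr1 in DF.
have [FF _] := kfib_double k n.
(* L_n is the square of L_{n/2} plus or minus 2, and L_{n/2} is odd because 3 does not divide
   n/2. *)
have l4 : (kluc k n %% 4 = 3)%N.
  have nE : n = (2 * n./2)%N by clear -on; lia.
  have oh : odd (kluc k n./2).
    by rewrite odd_kluc hkodd odd_kfib //; clear -n3 nE; lia.
  have L2 := kluc_double k n./2; rewrite -nE in L2.
  have {L2} : (kluc k n = kluc k n./2 ^ 2 + 2 \/ kluc k n + 2 = kluc k n./2 ^ 2)%N.
    move: L2; rewrite -signr_odd expr2 -mulnn; case: odd; rewrite ?expr1 ?expr0 => L2.
      by left; clear -L2; lia.
    by right; clear -L2; lia.
  have -> : kluc k n./2 = (2 * (kluc k n./2)./2 + 1)%N by clear -oh; lia.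
  move: (kluc k n) (kluc k n./2)./2 => x y.
  rewrite (_ : (2 * y + 1) ^ 2 = 4 * (y * y + y) + 1)%N; last by ring.
  by move: (y * y + y)%N => z; clear; lia.
move: LL DF FF hproper l4.
move: (kluc k n) (kluc k (2 * n)) (kfib k n) (kfib k (2 * n)) => l m f g.
move=> ml DF gE /andP[oQ copr] l4.
(* With 8a < d^2 this makes the right-hand numerator nonnegative for either sign, so it is a natural
   number [T] and can serve as a denominator. *)
have fl : (f <= l)%N by clear -DF; nia.
have [T TE] : {T : nat | T%:Z = eps * (8 * a * f)%N%:Z + (d ^ 2 * l)%N%:Z}.
  exists `|(eps * (8 * a * f)%N%:Z + (d ^ 2 * l)%N%:Z)%R|%N; rewrite gez0_abs //.
  have : (8 * a * f <= d ^ 2 * l)%N by rewrite leq_mul // ltnW.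
  move: (8 * a * f)%N (d ^ 2 * l)%N => u v; clear -heps.
  by case: heps => ->; lia.
have d8 : (d ^ 2 %% 8 = 1)%N.
  rewrite -mulnn -modnMm.
  have : (d %% 8 \in [:: 1; 3; 5; 7])%N by rewrite !inE; clear -hdodd; lia.
  by rewrite !inE => /or4P[]/eqP->.
have Tl : (T %% 8 = l %% 8)%N.
  have : ((d ^ 2 * l) %% 8 = l %% 8)%N by rewrite -modnMml d8 mul1n.
  move: TE; rewrite -mulnA; move: (a * f)%N (d ^ 2 * l)%N => u v.
  by clear -heps; case: heps => ->; lia.
rewrite -TE in copr *.
have -> : eps * (4 * a * g)%N%:Z + (d ^ 2)%N%:Z =
  eps * (4 * a%:Z * (f%:Z * l%:Z)) + d%:Z ^+ 2 by rewrite !PoszM gE; lia.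
apply: (jacobi_reduction _ _ (k%:Z ^+ 2 + 4) _ _ m) => //; lia.
Qed.
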